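(* Assume that the joint law of $(S_T,\max_{0\le t\le T}S_t)$ under $\mathbb{Q}$ is absolutely continuous with respect to two-dimensional Lebesgue measure $m_2$. Consider a payoff of the form $f=h\big(\max_{0\le t\le T}S_t,\,S_T\big)$ with $h$ continuous and with $V_f=\mathbb{E}_{\mathbb{Q}}f$ well defined and finite (that is, $f\in L^1(\mathbb{Q})$). Then $$V_f=\int_0^\infty\int_0^\infty-\frac{\partial^3}{\partial H\,\partial K^2}V_{f_B}(H,K)\Big|_{H=x,\,K=y}\ h(x,y)\,dx\,dy .$$
   Context: $\mathbb{Q}$ is a probability (pricing) measure, the interest rate is $0$, and $V_f=\mathbb{E}_{\mathbb{Q}}f$ denotes the price of a payoff $f$. $(S_t)_{0\le t\le T}$ is a stock price process with values in $(0,\infty)$, such that $\max_{0\le t\le T}S_t$ exists a.s. and has finite $\mathbb{Q}$-expectation. The barrier call payoff is $$f_B(H,K)=\mathbf{1}_{\max_{0\le t\le T}S_t\ge H}\,(S_T-K)^+ .$$ The partial derivatives (first twice in $K$, then once in $H$) are understood in the almost-everywhere sense with respect to Lebesgue measure. *)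

(* Defs.v *)
From mathcomp Require Export all_boot all_order all_algebra.
From mathcomp Require Export all_classical all_reals all_analysis.
Export Order.TTheory GRing.Theory Num.Theory.
Export numFieldNormedType.Exports.

#[export] Set Implicit Arguments.
#[export] Unset Strict Implicit.
#[export] Unset Printing Implicit Defensive.

Local Open Scope classical_set_scope.
Local Open Scope ring_scope.

Notation lebesgue2 R :=
  (@lebesgue_measure R \x @lebesgue_measure R)%E (only parsing).

(* The random variable [M] is a version of the maximum of [S] over [0, tT]:
   almost surely the maximum is attained and [M] is its value.  On the
   exceptional null set [M] is unconstrained, so that no measurability of a
   pointwise supremum over uncountably many times is needed. *)
Definition is_path_max (R : realType) (d : measure_display)
    (Omega : measurableType d) (Q : probability Omega R)
    (tT : R) (S : R -> {RV Q >-> R}) (M : {RV Q >-> R}) : Prop :=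
  {ae Q, forall w,
    (exists2 t, t \in `[0, tT] & M w = S t w) /\
    (forall t, t \in `[0, tT] -> S t w <= M w)}.

Definition barrier_call (R : realType) (Omega : Type)
    (M ST : Omega -> R) (H K : R) (w : Omega) : R :=
  \1_[set w' | H <= M w'] w * Num.max (ST w - K) 0.

(* [fine] loses nothing as soon as [0 < ST <= M] almost surely with [M]
   integrable: the expectation is then finite for all [H] and [K]. *)
Definition barrier_call_price (R : realType) (d : measure_display)
    (Omega : measurableType d) (Q : probability Omega R)
    (M ST : Omega -> R) (H K : R) : R :=
  fine ('E_Q[barrier_call M ST H K])%E.

(* Partial derivatives of [V : H -> K -> R].  As [derive1] is total, their
   existence has to be asserted separately with [derivable]. *)
Definition partial_H (R : realType) (V : R -> R -> R) (H K : R) : R :=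
  derive1 (V ^~ K) H.

Definition partial_K (R : realType) (V : R -> R -> R) (H K : R) : R :=
  derive1 (V H) K.

Definition partial_HKK (R : realType) (V : R -> R -> R) : R -> R -> R :=
  partial_H (partial_K (partial_K V)).

(* Each successive derivative exists at [m_2]-almost every point of the open
   quadrant. *)
Definition ae_derivable_HKK (R : realType) (V : R -> R -> R) : Prop :=
  {ae lebesgue2 R, forall z, 0 < z.1 -> 0 < z.2 ->
    [/\ derivable (V z.1) z.2 1,
        derivable (partial_K V z.1) z.2 1 &
        derivable ((partial_K (partial_K V)) ^~ z.2) z.1 1]}.

(* Main.v *)
From HB Require Import structures.
Require Import Defs.
From mathcomp Require Import all_boot all_order all_algebra.
From mathcomp Require Import all_classical all_reals all_analysis.
From mathcomp Require Import measurable_realfun lra.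
Import Order.TTheory GRing.Theory Num.Theory numFieldNormedType.Exports.

Local Open Scope classical_set_scope.
Local Open Scope ring_scope.

(* Let [g] be a density of the law of [(S_T, max S)].  Convexity of
   [K |-> (s - K)^+] gives [dV/dK = P(S_T <= K, max S >= H) - P(max S >= H)] at
   every [K].  For fixed [H], Lebesgue's differentiation theorem yields
   [d^2V/dK^2 = int_(m >= H) g(K, m) dm] for almost every [K].  The exceptional
   null set can be chosen independently of [H]: take the union of those of the
   rational [H], and use that increments in [K] are monotone in [H] while the
   limit is continuous in [H].  A second application of Lebesgue's theorem, now
   in [H], shows that minus the third derivative is [g(K, H)], and the formula
   is the change of variables followed by Fubini's theorem. *)

Local Notation plane R := (measurableTypeR R * measurableTypeR R)%type
  (only parsing).

(** * Derivatives from squeezed difference quotients *)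

Lemma is_derive_quotientP (R : realType) (F : R -> R) (x l : R) :
  is_derive x 1 F l <-> h^-1 * (F (h + x) - F x) @[h --> 0^'] --> l.
Proof.
have quotE : (fun h : R => h^-1 *: (F (h *: 1 + x) - F x)) =
    (fun h : R => h^-1 * (F (h + x) - F x)).
  by apply/funext => h; rewrite /GRing.scale/= mulr1.
split=> [[dF <-]|Fl].
  by rewrite /derive -quotE; exact: dF.
have dF : derivable F x 1.
  by apply/cvg_ex; exists l; rewrite quotE.
apply: DeriveDef => //; rewrite /derive quotE.
by apply/cvg_lim; [exact: Rhausdorff|].
Qed.

(** Taking the endpoints [x] and [h + x] puts the difference quotient between [f x] and [f (h + x)],
    in the order given by the sign of [h], so its error is at most [|f x - f (h + x)|]. Here [f]
    acts as a subgradient of a convex [F]. *)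
Lemma is_derive_secant_bounds (R : realType) (F f : R -> R) (x : R) :
  {for x, continuous f} ->
  (forall a b, a <= b -> (b - a) * f a <= F b - F a <= (b - a) * f b) ->
  is_derive x 1 F (f x).
Proof.
move=> cf Ff; apply/is_derive_quotientP/cvgrPdist_le => e e0.
have : f (h + x) @[h --> 0^'] --> f x.
  have hx : h + x @[h --> (0:R)^'] --> x.
    rewrite -[X in _ --> X]add0r; apply: cvgD; last exact: cvg_cst.
    by apply: cvg_within_filter; exact: cvg_id.
  exact: cvg_comp hx cf.
move=> /cvgrPdist_le/(_ e e0); apply: filter_app.
near=> h => fe.
have h0 : h != 0 by near: h; exact: nbhs_dnbhs_neq.
apply: le_trans fe.
set u := f x; set v := f (h + x).
case/orP: (lt_total h0) => hlt.
- have /Ff/andP[l1 l2] : h + x <= x by rewrite gerDr ltW.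
  have {}l1 : h * (h^-1 * (F (h + x) - F x)) <= h * v.
    by rewrite mulVKf//; rewrite -/v in l1; lra.
  have {}l2 : h * u <= h * (h^-1 * (F (h + x) - F x)).
    by rewrite mulVKf//; rewrite -/u in l2; lra.
  move: l1 l2; rewrite !(ler_nM2l hlt) => l1 l2.
  by rewrite !ger0_norm ?subr_ge0//; lra.
- have /Ff/andP[l1 l2] : x <= h + x by rewrite lerDr ltW.
  have {}l1 : h * u <= h * (h^-1 * (F (h + x) - F x)).
    by rewrite mulVKf//; rewrite -/u in l1; lra.
  have {}l2 : h * (h^-1 * (F (h + x) - F x)) <= h * v.
    by rewrite mulVKf//; rewrite -/v in l2; lra.
  move: l1 l2; rewrite !(ler_pM2l hlt) => l1 l2.
  by rewrite !ler0_norm ?subr_le0//; lra.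
Unshelve. all: by end_near. Qed.

(* The difference quotients of [W a] at [x] are squeezed between those of
   [W p] and [W q] for rationals [p < a < q], whose limits [G p] and [G q] are
   close to [G a]. *)
Lemma is_derive_monotone_family (R : realType) (W : R -> R -> R) (G : R -> R)
    (x a : R) :
  (forall q : rat, is_derive x 1 (W (ratr q)) (G (ratr q))) ->
  {for a, continuous G} ->
  (forall h h' k k', h <= h' -> k <= k' ->
    W h' k' - W h' k <= W h k' - W h k) ->
  is_derive x 1 (W a) (G a).
Proof.
move=> dW cG mW; apply/is_derive_quotientP/cvgrPdist_lt => e e0.
have e20 : 0 < e / 2 by rewrite divr_gt0.
have /nbhs_ballP[r/= r0 Gr] : \forall b \near a, `|G a - G b| < e / 2.
  by move/cvgrPdist_lt : cG; apply.
have /rat_in_itvoo[p /[!in_itv]/= /andP[p1 p2]] : a - r < a by rewrite gtrBl.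
have /rat_in_itvoo[q /[!in_itv]/= /andP[q1 q2]] : a < a + r by rewrite ltrDl.
have Gp : `|G a - G (ratr p)| < e / 2.
  by apply: Gr; rewrite /ball/= gtr0_norm; [lra|rewrite subr_gt0].
have Gq : `|G a - G (ratr q)| < e / 2.
  by apply: Gr; rewrite /ball/= ltr0_norm; [lra|rewrite subr_lt0].
have := dW p; move/is_derive_quotientP/cvgrPdist_lt => /(_ _ e20) dp.
have := dW q; move/is_derive_quotientP/cvgrPdist_lt => /(_ _ e20) dq.
near=> h.
have h0 : h != 0 by near: h; exact: nbhs_dnbhs_neq.
have dp' : `|G (ratr p) - h^-1 * (W (ratr p) (h + x) - W (ratr p) x)| < e / 2.
  by near: h.
have dq' : `|G (ratr q) - h^-1 * (W (ratr q) (h + x) - W (ratr q) x)| < e / 2.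
  by near: h.
(* For negative [h] the increment runs from [h + x] to [x] and [h^-1] reverses the order as well, so
   the quotients decrease in [b] for either sign of [h]. *)
have mono b b' : b <= b' ->
    h^-1 * (W b' (h + x) - W b' x) <= h^-1 * (W b (h + x) - W b x).
  move=> bb'; case/orP: (lt_total h0) => hlt.
  - rewrite ler_nM2l ?invr_lt0//.
    have := mW b b' (h + x) x bb'; rewrite gerDr => /(_ (ltW hlt)); lra.
  - rewrite ler_pM2l ?invr_gt0//.
    by have := mW b b' x (h + x) bb'; rewrite lerDr; apply; exact: ltW.
have l1 := mono _ _ (ltW p2); have l2 := mono _ _ (ltW q1).
move: Gp Gq dp' dq'; rewrite !ltr_norml.
move=> /andP[? ?] /andP[? ?] /andP[? ?] /andP[? ?].
by apply/andP; split; lra.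
Unshelve. all: by end_near. Qed.

(** * Integrals up to null sets, and primitives on the line *)

Section integral_ae.
Import HBNNSimple.

(* No measurability is asked for: the integral of a nonnegative function is a
   supremum of integrals of simple functions below it, and each of these can be
   set to [0] on a null set without changing its integral. *)
Lemma eq_integral_ae (d : measure_display) (T : measurableType d)
    (R : realType) (mu : {measure set T -> \bar R}) (D : set T)
    (f g : T -> \bar R) :
  {ae mu, forall x, D x -> f x = g x} ->
  (\int[mu]_(x in D) f x = \int[mu]_(x in D) g x)%E.
Proof.
move=> [N [mN N0 fgN]].
pose sup (f : T -> \bar R) := ereal_sup [set sintegral mu h |
  h in [set h : {nnsfun T >-> R} | forall x, ((h x)%:E <= f x)%E]].
have sup_le (u v : T -> \bar R) : (forall x, (0 <= v x)%E) ->
    (forall x, ~ N x -> u x = v x) -> (sup u <= sup v)%E.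
  move=> v0 uv; apply: ge_ereal_sup => _ [h /= hu <-].
  have mNC := measurableC mN.
  rewrite (_ : sintegral mu h = sintegral mu (proj_nnsfun h mNC)).
    apply: ereal_sup_ubound; exists (proj_nnsfun h mNC) => // x.
    rewrite -mrestrict patchE; case: ifPn => [/set_mem xN|_]; last exact: v0.
    by rewrite -uv.
  rewrite -!integralT_nnsfun.
  rewrite (ge0_negligible_integral mN)//; last 2 first.
    exact/measurable_EFinP.
    by move=> x _; rewrite lee_fin.
  rewrite [RHS](ge0_negligible_integral mN)//; last 2 first.
    exact/measurable_EFinP.
    by move=> x _; rewrite lee_fin.
  apply: eq_integral => x /set_mem[_ xN].
  by rewrite -mrestrict patchE mem_set.
have fg x : ~ N x -> (f \_ D) x = (g \_ D) x.
  move=> xN; rewrite !patchE; case: ifPn => // /set_mem Dx.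
  by apply: contrapT => fgx; apply: xN; apply: fgN => /(_ Dx).
rewrite /integral -/(sup _) -/(sup _); congr (_ - _)%E; apply/eqP.
- by rewrite eq_le; apply/andP; split; apply: sup_le => // x /fg;
    rewrite !funeposE => -> .
- by rewrite eq_le; apply/andP; split; apply: sup_le => // x /fg;
    rewrite !funenegE => -> .
Qed.

End integral_ae.

(** Absolute continuity of the integral: an increment of the primitive is an integral over an
    interval, which is small once the interval is short. *)
Lemma Rintegral_Ny_continuous (R : realType) (f : R -> R) :
  (@lebesgue_measure R).-integrable setT (EFin \o f) ->
  continuous (fun x => \int[lebesgue_measure]_(t in `]-oo, x]) f t).
Proof.
move=> fi x; apply/cvgrPdist_lt => e e0.
have [r [r0 fr]] := integral_normr_continuous fi e0.
have small a b : a <= b -> b - a < r ->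
    `|\int[lebesgue_measure]_(t in `]-oo, b]) f t -
      \int[lebesgue_measure]_(t in `]-oo, a]) f t| < e.
  move=> ab bar.
  have fiS : (@lebesgue_measure R).-integrable `]-oo, b] (EFin \o f).
    exact: integrableS fi.
  rewrite Rintegral_itvB ?bnd_simp//.
  apply: le_lt_trans (le_normr_Rintegral _ _) _ => //.
    exact: integrableS fi.
  apply: fr => //=; rewrite lebesgue_measure_itv/= lte_fin.
  by case: ifPn => _; rewrite -?EFinD lte_fin.
near=> y.
have xy : `|x - y| < r by near: y; exact: (@cvgr_dist_lt _ _ _ _ _ id x).
have [yx|/ltW yx] := leP y x.
  by apply: small => //; apply: le_lt_trans xy; exact: ler_norm.
rewrite distrC; apply: small => //; apply: le_lt_trans xy.
by rewrite distrC ler_norm.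
Unshelve. all: by end_near. Qed.

(** Lebesgue's differentiation theorem, used twice below: in the strike, with [f] a tail integral of
    the density, and in the barrier, with [f] a section of the density. *)
Lemma ae_is_derive_Rintegral_Ny (R : realType) (f : R -> R) :
  (@lebesgue_measure R).-integrable setT (EFin \o f) ->
  {ae @lebesgue_measure R, forall x : R,
    is_derive x 1 (fun y => \int[lebesgue_measure]_(t in `]-oo, y]) f t)
      (f x)}.
Proof.
move=> fi.
have fiS y : (@lebesgue_measure R).-integrable `]-oo, y] (EFin \o f).
  exact: integrableS fi.
have locf : locally_integrable setT f.
  by apply: open_integrable_locally => //; exact: openT.
have := FTC1Ny fiS locf; apply: filterS.
  exact: (ae_filter_ringOfSetsType lebesgue_measure).
move=> x [dF Fx].
exact: (DeriveDef dF (etrans (esym (derive1E _ _)) Fx)).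
Qed.

(** * Densities and almost-everywhere differentiability on product spaces *)

Section sigma_finite_product.
Context (d1 d2 : measure_display) (T1 : measurableType d1)
  (T2 : measurableType d2) (R : realType).
Variables (m1 : {sigma_finite_measure set T1 -> \bar R})
  (m2 : {sigma_finite_measure set T2 -> \bar R}).

(* An alias, because the sigma-finite instance that the library attaches to
   [m1 \x m2] is shadowed by the one for subprobabilities. *)
Definition sigma_finite_product := (m1 \x m2)%E.

HB.instance Definition _ := Measure.on sigma_finite_product.

Let sigma_finite_productP : sigma_finite setT sigma_finite_product.
Proof.
have /sigma_finiteP[F [FT ndF mF]] := sigma_finiteT m1.
have /sigma_finiteP[G [GT ndG mG]] := sigma_finiteT m2.
exists (fun n => F n `*` G n) => [|n].
  rewrite -setXTT FT GT; apply/seteqP; split=> [[x y] [[m _ Fx] [n _ Gy]]|].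
    (* Both exhausting sequences are nondecreasing, so one common index catches both coordinates. *)
    exists (maxn m n) => //; split.
      by move: Fx; exact/subsetPset/ndF/leq_maxl.
    by move: Gy; exact/subsetPset/ndG/leq_maxr.
  by move=> [x y] [n _ [Fx Gy]]; split; exists n.
have [[mFn Fn] [mGn Gn]] := (mF n, mG n).
split; first exact: measurableX.
by rewrite [X in (X < _)%E]product_measure1E// lte_mul_pinfty// ge0_fin_numE.
Qed.

HB.instance Definition _ := Measure_isSigmaFinite.Build _ _ _
  sigma_finite_product sigma_finite_productP.

End sigma_finite_product.

(* The density is set to [0] over the first coordinates where it is not
   integrable in the second one; these form a null set. *)
Lemma density_integrable_sections (d1 d2 : measure_display)
    (T1 : measurableType d1) (T2 : measurableType d2) (R : realType)
    (m1 : {sigma_finite_measure set T1 -> \bar R})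
    (m2 : {sigma_finite_measure set T2 -> \bar R})
    (nu : {finite_measure set (T1 * T2)%type -> \bar R}) :
  nu `<< (m1 \x m2)%E ->
  exists g : (T1 * T2)%type -> R,
  [/\ measurable_fun setT g, forall z, 0 <= g z,
      forall x, m2.-integrable setT (fun y => (g (x, y))%:E) &
      forall F : (T1 * T2)%type -> \bar R,
        measurable_fun setT F -> (forall z, (0 <= F z)%E) ->
        (\int[nu]_z F z = \int[m1 \x m2]_z (F z * (g z)%:E))%E].
Proof.
move=> numu.
pose f := Radon_Nikodym_SigmaFinite.f nu (sigma_finite_product m1 m2).
have f0 z : (0 <= f z)%E by exact: Radon_Nikodym_SigmaFinite.f_ge0.
have ffin z : f z \is a fin_num by exact: Radon_Nikodym_SigmaFinite.f_fin_num.
have fi : (m1 \x m2)%E.-integrable setT f.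
  exact: (@Radon_Nikodym_SigmaFinite.f_integrable _ _ _ nu
    (sigma_finite_product m1 m2) numu).
have mf : measurable_fun setT f by exact: measurable_int fi.
pose J := fubini_F m2 f.
have mJ : measurable_fun setT J by exact: measurable_fun_fubini_tonelli_F.
(* [N] is the set of first coordinates whose section has infinite integral. It is measurable as a
   level set of the partial integral [J], and null because it lies in the exceptional set [Z] of
   Fubini's theorem for the integrable [f]. *)
have J0 s : (0 <= J s)%E by exact: integral_ge0.
pose N := J @^-1` [set +oo%E].
have mN : measurable N by rewrite -[N]setTI; exact: mJ.
have [Z [mZ Z0 JZ]] := ae_integrable1 fi.
have N0 : m1 N = 0%E.
  apply/eqP; rewrite -measure_le0 -Z0; apply: le_measure; rewrite ?inE//.
  move=> s; rewrite /N/= => Js; apply: JZ => /= /integrableP[_].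
  under eq_integral do rewrite gee0_abs//.
  by rewrite -/(fubini_F _ _ _) -/J Js.
pose g (z : (T1 * T2)%type) := fine (f z) * \1_(~` N) z.1.
have mg : measurable_fun setT g.
  apply: measurable_funM.
    exact: (measurableT_comp (@fine_measurable _ _ measurableT) mf).
  apply: (measurableT_comp _ measurable_fst).
  exact/measurable_indic/measurableC.
exists g; split => //.
- by move=> z; rewrite mulr_ge0 ?fine_ge0// indicE ler0n.
- move=> s; rewrite /g/=.
  have [sN|sN] := pselect (N s).
    rewrite [X in _.-integrable _ X](_ : _ = cst 0%E).
      exact: integrable0.
    by apply/funext => m; rewrite indicE memNset ?mulr0//= => /(_ sN).
  have -> : (fun m => (fine (f (s, m)) * \1_(~` N) s)%:E) = (fun m => f (s, m)).
    by apply/funext => m; rewrite indicE mem_set// mulr1 fineK.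
  apply/integrableP; split; first exact: measurableT_comp.
  under eq_integral do rewrite gee0_abs//.
  by rewrite ltey; apply/eqP.
- move=> F mF F0.
  rewrite -(@Radon_Nikodym_SigmaFinite.change_of_variables _ _ _ nu
    (sigma_finite_product m1 m2) numu)//.
  apply: eq_integral_ae; exists (N `*` setT); split.
  - exact: measurableX.
  - by rewrite [LHS]product_measure1E// [X in (X * _)%E]N0 mul0e.
  - move=> z /= zN; split => //; apply: contrapT => Nz; apply: zN => _.
    by rewrite -/f /g indicE mem_set// mulr1 fineK.
Qed.

(* Continuity reduces the differentiability condition to rational increments;
   this makes the exceptional set [B] measurable in the plane. *)
Lemma ae_plane_is_derive (R : realType) (G l : plane R -> R) :
  measurable_fun setT G -> measurable_fun setT l ->
  (forall k : R, continuous (fun x : R => G (x, k))) ->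
  (forall k : R, {ae @lebesgue_measure R, forall x : R,
    is_derive x 1 (fun y : R => G (y, k)) (l (x, k))}) ->
  {ae lebesgue2 R, forall z,
    is_derive (z.1 : R) 1 (fun y : R => G (y, z.2)) (l z)}.
Proof.
move=> mG ml cG dG.
(* On [E n k q] an increment [q] below [1/(k+1)] misses the linear approximation of slope [l z] by
   more than [|q|/(n+1)]; [B] is the negated epsilon-delta condition. With the error multiplied by
   [|q|], the increment [0] can never be a witness. *)
pose E n k (q : rat) : set (plane R) := [set z |
  (`|ratr q| < k.+1%:R^-1 :> R) &&
  (`|ratr q| / n.+1%:R < `|G (z.1 + ratr q, z.2) - G z - ratr q * l z|)].
pose B := \bigcup_n \bigcap_k \bigcup_q E n k q.
have mE n k q : measurable (E n k q).
  rewrite /E; case: ltP => _ /=; last first.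
    by rewrite (_ : mkset _ = set0)//; apply/seteqP; split.
  rewrite -[X in measurable X]setTI; apply: measurable_fun_ltr => //.
  apply: measurableT_comp => //; apply: measurable_funB.
    apply: measurable_funB => //; apply: (measurableT_comp mG).
    apply/measurable_fun_pairP; split.
      exact: (measurable_funD measurable_fst).
    exact: measurable_snd.
  by apply: measurable_funM.
have mB : measurable B.
  apply: bigcupT_measurable => n; apply: bigcapT_measurable => k.
  exact: bigcupT_measurable_rat.
have derivB (x k : R) : is_derive x 1 (fun y : R => G (y, k)) (l (x, k)) ->
    ~ B (x, k).
  move=> /is_derive_quotientP/cvgrPdist_le dGx [n _ Bn].
  have n0 : (0 : R) < n.+1%:R^-1 by rewrite invr_gt0.
  have [r/= r0 dr] := dGx _ n0.
  have [m _ /(_ _ (leqnn m))/= mr] := near_infty_natSinv_lt (PosNum r0).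
  have [q _ /andP[/= q1]] := Bn m I.
  rewrite ltNge => /negP; apply.
  have [->|q0] := eqVneq (ratr q) (0 : R).
    by rewrite addr0 subrr mul0r subr0 normr0 mul0r.
  have := dr (ratr q); rewrite /= sub0r normrN => /(_ (lt_trans q1 mr) q0).
  rewrite (_ : G (x + _, k) - _ - _ = - (ratr q * (l (x, k) -
      (ratr q)^-1 * (G (ratr q + x, k) - G (x, k))))).
    by rewrite normrN normrM; exact: ler_wpM2l.
  by rewrite mulrBr mulVKf// opprB (addrC x).
have Bderiv (x k : R) : ~ B (x, k) ->
    is_derive x 1 (fun y : R => G (y, k)) (l (x, k)).
  move=> nB; apply/is_derive_quotientP/cvgrPdist_le => e e0.
  have [n _ /(_ _ (leqnn n))/= ne] := near_infty_natSinv_lt (PosNum e0).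
  have [m mP] : exists m, forall q, ~ E n m q (x, k).
    apply: contrapT => nm; apply: nB; exists n => // m _.
    apply: contrapT => nq; apply: nm; exists m => q Eq; apply: nq.
    by exists q.
  have m0 : (0 : R) < m.+1%:R^-1 by rewrite invr_gt0.
  near=> h.
  have h0 : h != 0 by near: h; exact: nbhs_dnbhs_neq.
  have hm : `|h| < m.+1%:R^-1.
    by near: h; apply: dnbhs0_lt.
  (* If the bound failed at a real [h], continuity in the first variable would make it fail at a
     rational just above [h] and still below [1/(m+1)], which [mP] excludes. *)
  have {}hm : `|G (h + x, k) - G (x, k) - h * l (x, k)| <= `|h| / n.+1%:R.
    rewrite leNgt; apply/negP => hn.
    have c1 : {for h, continuous (fun y : R =>
        `|G (y + x, k) - G (x, k) - y * l (x, k)| - `|y| / n.+1%:R)}.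
      apply: cvgB; last first.
        by apply: cvgMl; exact: norm_continuous.
      apply: cvg_norm; apply: cvgB; last by apply: cvgMl; exact: cvg_id.
      apply: cvgB; last exact: cvg_cst.
      have hx : y + x @[y --> h] --> h + x.
        by apply: cvgD; [exact: cvg_id|exact: cvg_cst].
      exact: cvg_comp hx (cG k (h + x)).
    have : \forall y \near h, 0 <
        `|G (y + x, k) - G (x, k) - y * l (x, k)| - `|y| / n.+1%:R.
      by have /cvgr_gt := c1; apply; rewrite subr_gt0.
    have : \forall y \near h, `|y| < m.+1%:R^-1.
      by have /cvgr_lt := @norm_continuous _ _ h; apply.
    move=> N1 N2; have /nbhs_ballP[r/= r0 Gr] : nbhs h
        ([set y : R | `|y| < m.+1%:R^-1] `&` [set y : R | 0 <
          `|G (y + x, k) - G (x, k) - y * l (x, k)| - `|y| / n.+1%:R]).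
      exact: filterI.
    have /rat_in_itvoo[q] : h < h + r by rewrite ltrDl.
    rewrite in_itv/= => /andP[q1 q2].
    have [] := Gr (ratr q); first by rewrite /ball/= ltr0_norm ?subr_lt0//; lra.
    rewrite /= subr_gt0 => a1 a2; apply: (mP q); apply/andP; split => //=.
    by rewrite (addrC x).
  rewrite (_ : _ - _ = - (h^-1 * (G (h + x, k) - G (x, k) - h * l (x, k)))).
    rewrite normrN normrM normfV ler_pdivrMl ?normr_gt0//.
    apply: (le_trans hm); rewrite ler_wpM2l//; exact: ltW.
  by rewrite [in RHS]mulrBr mulKf// opprB.
exists B; split => //; last first.
  move=> [x k] /= nd; apply: contrapT => nB; apply: nd; exact: Bderiv.
(* By Tonelli it suffices that, for each fixed second coordinate, the section of [B] is null, and
   [derivB] places it in the exceptional set of [dG k]. *)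
rewrite -[B]setIT -(integral_indic _ measurableT mB).
rewrite (fubini_tonelli2 (EFin \o \1_B)); last 2 first.
  exact/measurable_EFinP/measurable_indic.
  by move=> z; rewrite lee_fin indicE.
rewrite (@eq_integral_ae _ _ _ _ _ _ (cst 0%E)) ?integral0//.
apply: aeW => k _; rewrite /fubini_G.
rewrite (@eq_integral_ae _ _ _ _ _ _ (cst 0%E)) ?integral0//.
apply: filterS (dG k).
  exact: (ae_filter_ringOfSetsType lebesgue_measure).
by move=> x /derivB nB _; rewrite /= indicE memNset.
Unshelve. all: by end_near. Qed.

(** * Tail integrals of a density with integrable sections *)

Section tail_of_density.
Context (R : realType).
Variable g : plane R -> R.
Hypothesis mg : measurable_fun setT g.
Hypothesis g0 : forall z, 0 <= g z.
Hypothesis g_section : forall k : R,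
  (@lebesgue_measure R).-integrable setT (fun m : R => (g (k, m))%:E).
Hypothesis g_lty : (\int[lebesgue2 R]_z (g z)%:E < +oo)%E.

Notation la := (@lebesgue_measure R).

(** Arguments are barrier, then strike, as in the price; [g] takes the stock value first and the
    maximum second. This is the candidate for the second strike derivative. *)
Definition tail (x k : R) : R := \int[la]_(m in `[x, +oo[) g (k, m).

(** For the density of the law of stock and maximum, this is the probability that the stock is at
    most [k] and the maximum at least [x]. *)
Definition cumul_tail (x k : R) : R := \int[la]_(s in `]-oo, k]) tail x s.

Let g_sectionS (A : set R) k : measurable A ->
  la.-integrable A (fun m => (g (k, m))%:E).
Proof. by move=> mA; exact: integrableS (g_section k). Qed.

Lemma EFin_tail x k :
  (tail x k)%:E = (\int[la]_(m in `[x, +oo[) (g (k, m))%:E)%E.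
Proof.
by rewrite fineK//; apply: integrable_fin_num => //; exact: g_sectionS.
Qed.

Lemma tail_ge0 x k : 0 <= tail x k.
Proof. by apply: Rintegral_ge0. Qed.

(** Turns the moving lower limit into a primitive from minus infinity, the form to which the
    continuity and differentiation lemmas apply. *)
Lemma tail_Ny x k :
  tail x k = \int[la]_m g (k, m) - \int[la]_(m in `]-oo, x]) g (k, m).
Proof.
have := @Rintegral_itvB R (fun m => g (k, m)) -oo%O +oo%O x.
rewrite set_itvE => ->//; last exact: g_section.
by rewrite Rintegral_itv_obnd_cbnd//; exact: g_sectionS.
Qed.

Lemma tail_le x y k : x <= y -> tail y k <= tail x k.
Proof.
move=> xy; rewrite -lee_fin !EFin_tail; apply: ge0_subset_integral => //.
- by have /measurable_int := g_sectionS k (measurable_itv `[x, +oo[).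
- by move=> m _; rewrite lee_fin.
- by apply: subset_itvr; rewrite bnd_simp.
Qed.

Lemma tail_continuous k : continuous (tail ^~ k).
Proof.
rewrite (_ : tail ^~ k = fun x =>
  \int[la]_m g (k, m) - \int[la]_(m in `]-oo, x]) g (k, m)).
  move=> x; apply: cvgB; first exact: cvg_cst.
  exact: (Rintegral_Ny_continuous (g_section k)).
by apply/funext => x; exact: tail_Ny.
Qed.

Lemma ae_is_derive_tail k :
  {ae la, forall x : R, is_derive x 1 (tail ^~ k) (- g (k, x))}.
Proof.
have := ae_is_derive_Rintegral_Ny (g_section k); apply: filterS.
  exact: (ae_filter_ringOfSetsType la).
move=> x dx; rewrite (_ : tail ^~ k = fun x =>
  \int[la]_m g (k, m) - \int[la]_(m in `]-oo, x]) g (k, m)); last first.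
  by apply/funext => y; exact: tail_Ny.
by apply: is_derive_eq; rewrite add0r mul1r.
Qed.

(** The moving limit becomes an indicator in the variables [((x, k), m)], so joint measurability is
    that of a Tonelli partial integral. *)
Lemma measurable_tail : measurable_fun setT (fun z : plane R => tail z.1 z.2).
Proof.
pose f (z : plane R * measurableTypeR R) : \bar R :=
  (g (z.1.2, z.2) *
   \1_[set u : plane R * measurableTypeR R | u.1.1 <= u.2] z)%:E.
have mf : measurable_fun setT f.
  apply/measurable_EFinP; apply: measurable_funM.
    apply: (measurableT_comp mg); apply/measurable_fun_pairP; split.
      exact: (measurableT_comp measurable_snd measurable_fst).
    exact: measurable_snd.
  apply: measurable_indic; rewrite -[X in measurable X]setTI.
  apply: measurable_fun_ler => //.
  exact: (measurableT_comp measurable_fst measurable_fst).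
have f0 z : (0 <= f z)%E by rewrite lee_fin mulr_ge0// indicE.
have mF := measurable_fun_fubini_tonelli_F (m2 := la) f mf f0.
rewrite (_ : (fun z => _) = fine \o fubini_F la f).
  exact: (measurableT_comp (fine_measurable measurableT) mF).
apply/funext => -[x k]; rewrite /= /tail /Rintegral /fubini_F integral_mkcond.
congr fine; apply: eq_integral => m _; rewrite patchE /f/= indicE.
rewrite [in RHS](_ : (_ \in _) = (m \in `[x, +oo[%classic)).
  by case: ifP => _; rewrite (mulr1, mulr0).
by apply/idP/idP => /set_mem/= xm; apply/mem_set; move: xm;
  rewrite /= in_itv/= andbT.
Qed.

Let measurable_tail_section x : measurable_fun setT (tail x).
Proof. exact: (measurableT_comp measurable_tail (pair1_measurable x)). Qed.

Lemma integrable_tail x : la.-integrable setT (EFin \o tail x).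
Proof.
apply/integrableP; split.
  apply/measurable_EFinP; exact: measurable_tail_section.
apply: le_lt_trans g_lty.
have mgE : measurable_fun setT (EFin \o g) by exact/measurable_EFinP.
have gE z : (0 <= (EFin \o g) z)%E by rewrite lee_fin.
rewrite (fubini_tonelli1 _ mgE gE).
apply: ge0_le_integral => //.
- apply/measurable_EFinP/measurableT_comp => //; exact: measurable_tail_section.
- exact: measurable_fun_fubini_tonelli_F.
- move=> k _; rewrite /= ger0_norm ?tail_ge0// EFin_tail.
  apply: ge0_subset_integral => //.
    by have /measurable_int := g_section k.
  by move=> m _; rewrite lee_fin.
Qed.

Lemma cumul_tail_continuous x : continuous (cumul_tail x).
Proof. exact: Rintegral_Ny_continuous (integrable_tail x). Qed.

Lemma EFin_cumul_tail x k : (cumul_tail x k)%:E =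
  (\int[lebesgue2 R]_(z in `]-oo, k] `*` `[x, +oo[) (g z)%:E)%E.
Proof.
rewrite fineK; last first.
  by apply: integrable_fin_num => //; exact: integrableS (integrable_tail x).
rewrite [RHS]integral_mkcond fubini_tonelli1; last 2 first.
  apply/(measurable_restrictT _ _).1; first exact: measurableX.
  by apply/measurable_EFinP/measurable_funTS.
  by apply: erestrict_ge0 => z _; rewrite lee_fin.
rewrite [LHS]integral_mkcond; apply: eq_integral => s _.
rewrite /fubini_F patchE; case: ifPn => sk.
  rewrite EFin_tail [LHS]integral_mkcond; apply: eq_integral => m _.
  by rewrite !patchE in_setX sk.
by rewrite integral0_eq// => m _; rewrite patchE in_setX (negbTE sk).
Qed.

(** Supplies the monotonicity required by [is_derive_monotone_family]: an increment in [k]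
    integrates [tail], which decreases in the barrier. *)
Lemma cumul_tail_increment x x' k k' : x <= x' -> k <= k' ->
  cumul_tail x' k' - cumul_tail x' k <= cumul_tail x k' - cumul_tail x k.
Proof.
move=> xx' kk'.
have it y A : measurable A -> la.-integrable A (EFin \o tail y).
  by move=> mA; exact: integrableS (integrable_tail y).
have incr y : cumul_tail y k' - cumul_tail y k =
    \int[la]_(s in `]k, k']) tail y s.
  by apply: Rintegral_itvB; rewrite ?bnd_simp//; exact: it.
rewrite [leLHS]incr [leRHS]incr.
apply: le_Rintegral.
- exact: measurable_itv.
- exact: it.
- exact: it.
- by move=> s _; exact: tail_le.
Qed.

Lemma ae_is_derive_cumul_tail : {ae la, forall k : R, forall x : R,
  is_derive k 1 (cumul_tail x) (tail x k)}.
Proof.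
have : {ae la, forall k : R, forall q : rat,
    is_derive k 1 (cumul_tail (ratr q)) (tail (ratr q) k)}.
  (* Enumerating the rationals makes this a countable intersection; codes of no rational default to
     [0], where the claim is true anyway. *)
  have : {ae la, forall k : R, forall n : nat,
      let q : rat := odflt 0 (unpickle n) in
      is_derive k 1 (cumul_tail (ratr q)) (tail (ratr q) k)}.
    apply/ae_foralln => n.
    exact: ae_is_derive_Rintegral_Ny (integrable_tail _).
  apply: filterS; first exact: (ae_filter_ringOfSetsType la).
  by move=> k dk q; have := dk (pickle q); rewrite pickleK.
apply: filterS; first exact: (ae_filter_ringOfSetsType la).
move=> k dk x; apply: (@is_derive_monotone_family R cumul_tail (tail ^~ k) k x).
- exact: tail_continuous.
- exact: cumul_tail_increment.
Qed.

End tail_of_density.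

(** * Integration against a density, and the first strike derivative *)

Lemma integral_density (d : measure_display) (T : measurableType d)
    (R : realType) (m nu : {measure set T -> \bar R}) (g : T -> R) :
  measurable_fun setT g -> (forall x, 0 <= g x) ->
  (forall F : T -> \bar R, measurable_fun setT F -> (forall x, (0 <= F x)%E) ->
    (\int[nu]_x F x = \int[m]_x (F x * (g x)%:E))%E) ->
  forall F : T -> \bar R, nu.-integrable setT F ->
    m.-integrable setT (fun x => F x * (g x)%:E)%E /\
    (\int[nu]_x F x = \int[m]_x (F x * (g x)%:E))%E.
Proof.
move=> mg g0 dens F /integrableP[mF Foo].
have g0E x : (0 <= (g x)%:E)%E by rewrite lee_fin.
split.
  apply/integrableP; split.
    by apply: emeasurable_funM => //; exact/measurable_EFinP.
  under eq_integral do rewrite abseM (gee0_abs (g0E _)).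
  by rewrite -dens//; exact: measurableT_comp.
rewrite integralE [RHS]integralE !dens//; [|exact: measurable_funeneg
  |exact: measurable_funepos].
(* Multiplying by the nonnegative [g] commutes with taking positive and negative parts. *)
congr (_ - _)%E; apply: eq_integral => x _.
- by rewrite !funeposE ![(_ * (g x)%:E)%E]muleC maxe_pMr// mule0.
- by rewrite !funenegE -mulNe ![(_ * (g x)%:E)%E]muleC maxe_pMr// mule0.
Qed.

(** Between strikes [a <= b] the payoff drops by at least [b - a] where the stock exceeds [b], and
    by at most [b - a], only where it exceeds [a]. Taking expectations gives the secant bounds with
    slope [- p]. *)
Lemma is_derive_barrier_call_price (R : realType) (d : measure_display)
    (Omega : measurableType d) (Q : probability Omega R)
    (M ST : {RV Q >-> R}) (H : R) (p : R -> R) (K : R) :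
  Q.-integrable setT (EFin \o ST) ->
  (forall k, (p k)%:E = Q [set w | H <= M w /\ k < ST w]) ->
  {for K, continuous p} ->
  is_derive K 1 (barrier_call_price Q M ST H) (- p K).
Proof.
move=> iST pE cp.
pose A k := [set w | H <= M w /\ k < ST w].
have mM : measurable_fun setT M by exact: measurable_funPT.
have mST : measurable_fun setT ST by exact: measurable_funPT.
have mH : measurable [set w | H <= M w].
  rewrite -[X in measurable X]setTI.
  exact: (measurable_fun_ler (measurable_cst H) mM).
have mA k : measurable (A k).
  apply: measurableI => //; rewrite -[X in measurable X]setTI.
  exact: (measurable_fun_ltr (measurable_cst k) mST).
have iA k : Q.-integrable setT (EFin \o \1_(A k)).
  exact: integrable_indic.
have pI k : p k = \int[Q]_w \1_(A k) w.
  apply: EFin_inj; rewrite pE /Rintegral integral_indic// setIT fineK//.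
  exact: fin_num_measure.
have iB k : Q.-integrable setT (EFin \o barrier_call M ST H k).
  have ik : Q.-integrable setT (EFin \o (ST \- cst k)).
    exact: (integrableB measurableT iST 
      (finite_measure_integrable_cst Q k measurableT)).
  apply: le_integrable ik => //.
    apply/measurable_EFinP/measurable_funM; first exact: measurable_indic.
    by apply: measurable_maxr => //; exact: measurable_funB.
  move=> w _ /=; rewrite lee_fin /barrier_call indicE normrM.
  rewrite -[leRHS]mul1r ler_pM//.
    by case: (_ \in _); rewrite ?normr1 ?normr0.
  by rewrite /Num.max; case: ifP => //; rewrite normr0.
have VI k : barrier_call_price Q M ST H k = \int[Q]_w barrier_call M ST H k w.
  by rewrite /barrier_call_price unlock.
apply: (@is_derive_secant_bounds _ _ (fun k => - p k)).
  exact: cvgN.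
move=> a b ab.
have ba0 : 0 <= b - a by rewrite subr_ge0.
have inc w : (b - a) * \1_(A b) w <=
    barrier_call M ST H a w - barrier_call M ST H b w <= (b - a) * \1_(A a) w.
  have AE k : (w \in A k) = (H <= M w) && (k < ST w).
    by apply/idP/idP => [/set_mem/andP|/andP]//; exact: mem_set.
  have HE : (w \in [set w' | H <= M w']) = (H <= M w).
    by apply/idP/idP => [/set_mem|]//; exact: mem_set.
  rewrite /barrier_call !indicE !AE HE.
  case: (H <= M w) => /=; last by rewrite !mul0r mulr0 subr0 lexx.
  rewrite !mul1r /Num.max !subr_lt0.
  by case: (ltP b (ST w)) => hb; case: (ltP a (ST w)) => ha;
    case: (ltP (ST w) b) => hb'; case: (ltP (ST w) a) => ha' //=; apply/andP;
    split; rewrite ?mulr0 ?mulr1; lra.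
have le1 : (b - a) * p b <=
    barrier_call_price Q M ST H a - barrier_call_price Q M ST H b.
  rewrite !VI -RintegralB// pI -RintegralZl//; apply: le_Rintegral => //.
  - exact: (integrableZl measurableT _ (iA b)).
  - exact: (integrableB measurableT (iB a) (iB b)).
  - by move=> w _; have /andP[] := inc w.
have le2 : barrier_call_price Q M ST H a - barrier_call_price Q M ST H b <=
    (b - a) * p a.
  rewrite !VI -RintegralB// pI -RintegralZl//; apply: le_Rintegral => //.
  - exact: (integrableB measurableT (iB a) (iB b)).
  - exact: (integrableZl measurableT _ (iA a)).
  - by move=> w _; have /andP[] := inc w.
by lra.
Qed.

(** * Measurability and null sets in the plane *)

Lemma open_plane_measurable (R : realType) (A : set (R * R)%type) :
  open A -> measurable (A : set (plane R)).
Proof.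
move=> oA.
pose box (a b c e : rat) : set (plane R) :=
  `]ratr a, ratr b[%classic `*` `]ratr c, ratr e[%classic.
(* Boxes not contained in [A] are replaced by the empty set, so that the union can range over all
   rational corners. *)
pose boxA a b c e : set (plane R) :=
  if `[< box a b c e `<=` A >] then box a b c e else set0.
suff -> : A = \bigcup_a \bigcup_b \bigcup_c \bigcup_e boxA a b c e.
  do 4!apply: bigcupT_measurable_rat => ?; rewrite /boxA; case: ifP => _ //.
  exact: measurableX.
apply/seteqP; split=> [[x y] Axy|z [a _ [b _ [c _ [e _]]]]]; last first.
  by rewrite /boxA; case: ifPn => // /asboolP; exact.
move: oA; rewrite openE => /(_ _ Axy) /nbhs_ballP[r/= r0 rA].
have [xr yr] : x - r < x /\ y - r < y by split; rewrite gtrBl.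
have [xr' yr'] : x < x + r /\ y < y + r by split; rewrite ltrDl.
have /rat_in_itvoo[a /[!in_itv]/= /andP[a1 a2]] := xr.
have /rat_in_itvoo[b /[!in_itv]/= /andP[b1 b2]] := xr'.
have /rat_in_itvoo[c /[!in_itv]/= /andP[c1 c2]] := yr.
have /rat_in_itvoo[e /[!in_itv]/= /andP[e1 e2]] := yr'.
exists a => //; exists b => //; exists c => //; exists e => //.
rewrite /boxA; case: ifPn => [_|/asboolPn[]].
  by split; rewrite /= in_itv/= ?a2 ?b1 ?c2 ?e1.
move=> [u v] [/=]; rewrite !in_itv/= => /andP[u1 u2] /andP[v1 v2].
by apply: rA; split; rewrite /ball/= ltr_norml; apply/andP; split; lra.
Qed.

Lemma open_continuous_plane_measurable_fun (R : realType) (D : set (R * R)%type)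
    (h : (R * R)%type -> R) :
  open D -> {within D, continuous h} ->
  measurable_fun (D : set (plane R)) (h : plane R -> R).
Proof.
move=> oD /continuousP ch.
apply: (measurability _ (RGenOpens.measurableE R)).
move=> _ [_ [a [b ->] <-]].
have /open_subspaceP[V oV VD] :
    open ((h : subspace D -> R) @^-1` `]a, b[%classic).
  exact/ch/interval_open.
rewrite setIC -VD; apply: open_plane_measurable; exact: openI.
Qed.

Lemma ae_plane_snd (R : realType) (P : R -> Prop) :
  {ae @lebesgue_measure R, forall k : R, P k} ->
  {ae lebesgue2 R, forall z : plane R, P z.2}.
Proof.
move=> [N [mN N0 PN]]; exists (setT `*` N); split.
- exact: measurableX.
- by rewrite [LHS]product_measure1E// [X in (_ * X)%E]N0 mule0.
- by move=> [x k] nP; split => //; exact: PN.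
Qed.

(** * Identification of the third derivative and the pricing formula *)

Theorem theorem2p3 (R : realType) (d : measure_display)
    (Omega : measurableType d) (Q : probability Omega R)
    (tT : R) (htT : 0 <= tT)
    (S : R -> {RV Q >-> R})
    (S_gt0 : forall t w, t \in `[0, tT] -> 0 < S t w)
    (M : {RV Q >-> R})
    (M_max : is_path_max tT S M)
    (M_int : Q.-integrable setT (EFin \o M))
    (joint_ac :
      pushforward Q (fun w => (S tT w, M w)
                       : measurableTypeR R * measurableTypeR R)
        `<< lebesgue2 R)
    (h : R * R -> R)
    (h_cont : {within `]0, +oo[ `*` `]0, +oo[, continuous h})
    (f_int : Q.-integrable setT (fun w => (h (M w, S tT w))%:E)) :
  let V := barrier_call_price Q M (S tT) in
  ae_derivable_HKK V /\
  ('E_Q[fun w => h (M w, S tT w)] =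
    \int[lebesgue_measure]_(y in `]0%R, +oo[)
      \int[lebesgue_measure]_(x in `]0%R, +oo[)
        (- partial_HKK V x y * h (x, y))%:E)%E.
Proof.
move=> V.
set ST := S tT; pose la := @lebesgue_measure R.
have ST_gt0 w : 0 < ST w by apply: S_gt0; rewrite in_itv/= htT lexx.
have ST_le_M : {ae Q, forall w, ST w <= M w}.
  apply: filterS M_max => w [_ SM].
  by apply: SM; rewrite in_itv/= htT lexx.
have mST : measurable_fun setT ST by exact: measurable_funPT.
have mM : measurable_fun setT M by exact: measurable_funPT.
(* The stock comes first, as in [joint_ac], so the density is read at [(y, x)] where [h] is read at
   [(x, y)]. *)
pose phi w : plane R := (ST w, M w).
have mphi : measurable_fun setT phi by exact: measurable_fun_pair.
pose X : {mfun Omega >-> plane R} :=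
  MeasurableFun.Pack (MeasurableFun.Class
    (isMeasurableFun.Build _ _ _ _ phi mphi)).
pose nu := distribution Q X.
have [g [mg g0 gs dens]] :=
  @density_integrable_sections _ _ _ _ R la la nu joint_ac.
have nuT : nu setT = 1%E by exact: probability_setT.
have g_lty : (\int[lebesgue2 R]_z (g z)%:E < +oo)%E.
  have := dens (cst 1%E) (measurable_cst _) (fun=> lee01).
  rewrite integral_cst// mul1e [X in X = _ -> _]nuT.
  under eq_integral do rewrite mul1e.
  by move=> <-; exact: ltry.
have cumulE x k : (cumul_tail g x k)%:E = Q [set w | ST w <= k /\ x <= M w].
  pose A : set (plane R) := `]-oo, k] `*` `[x, +oo[.
  have mA : measurable A by exact: measurableX.
  have m1A : measurable_fun setT (fun z => (\1_A z : R)%:E).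
    by apply/measurable_EFinP; exact: measurable_indic.
  rewrite EFin_cumul_tail// -/A.
  have A0 z : (0 <= (\1_A z : R)%:E)%E by rewrite lee_fin indicE.
  transitivity (\int[lebesgue2 R]_z ((\1_A z)%:E * (g z)%:E))%E.
    rewrite integral_mkcond; apply: eq_integral => z _.
    by rewrite patchE indicE; case: ifP; rewrite ?mul1e ?mul0e.
  rewrite -(dens _ m1A A0) integral_indic// setIT.
  congr (Q _); apply/seteqP; split=> w /=.
    by move=> []; rewrite /= !in_itv/= andbT.
  by move=> [? ?]; split; rewrite /= in_itv/= ?andbT.
pose P H := fine (Q [set w | H <= M w]).
have mMle H : measurable [set w | H <= M w].
  rewrite -[X in measurable X]setTI.
  exact: (measurable_fun_ler (measurable_cst H) mM).
have pE H k : (P H - cumul_tail g H k)%:E = Q [set w | H <= M w /\ k < ST w].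
  have mlt : measurable [set w | k < ST w].
    rewrite -[X in measurable X]setTI.
    exact: (measurable_fun_ltr (measurable_cst k) mST).
  have mle : measurable [set w | ST w <= k].
    rewrite -[X in measurable X]setTI.
    exact: (measurable_fun_ler mST (measurable_cst k)).
  have QU : Q [set w | H <= M w] = (Q [set w | (ST w <= k /\ H <= M w)%R] +
      Q [set w | (H <= M w /\ k < ST w)%R])%E.
    rewrite -measureU.
    - congr (Q _); apply/seteqP; split=> [w /= HM|w [[]|[]]//].
      by have [?|?] := leP (ST w) k; [left|right].
    - exact: (measurableI _ _ mle (mMle H)).
    - exact: (measurableI _ _ (mMle H) mlt).
    - by apply/seteqP; split=> // w [[/= + _] [_ +]]; rewrite leNgt => /negP.
  rewrite EFinB fineK ?fin_num_measure// QU cumulE addeAC subee ?add0e//.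
  by rewrite fin_num_measure//; exact: (measurableI _ _ mle (mMle H)).
have iST : Q.-integrable setT (EFin \o ST).
  apply/integrableP; split; first exact/measurable_EFinP.
  move/integrableP : M_int => [_]; apply: le_lt_trans.
  apply: ae_ge0_le_integral => //.
  - by apply: measurableT_comp => //; exact/measurable_EFinP.
  - by apply: measurableT_comp => //; exact/measurable_EFinP.
  apply: filterS ST_le_M => w wM _ /=; rewrite lee_fin !ger0_norm//.
    by rewrite (le_trans _ wM)// ltW.
  exact: ltW.
have cumulC H := cumul_tail_continuous mg g0 gs g_lty H.
(* Continuity of [cumul_tail] gives the first strike derivative at every [K], so [partial_K V H] is
   known as a function and can be differentiated again. *)
have dV H (K : R) : is_derive K 1 (V H) (cumul_tail g H K - P H).
  apply: is_derive_eq.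
    apply: (is_derive_barrier_call_price iST (pE H)).
    by apply: cvgB; [exact: cvg_cst|exact: cumulC].
  by rewrite opprB.
have VK H : partial_K V H = fun K => cumul_tail g H K - P H.
  by apply/funext => K; rewrite /partial_K derive1E derive_val.
have good := ae_is_derive_cumul_tail mg g0 gs g_lty.
have dVK H (K : R) : is_derive K 1 (cumul_tail g H) (tail g H K) ->
    is_derive K 1 (partial_K V H) (tail g H K).
  by move=> ?; rewrite VK; apply: is_derive_eq; rewrite subr0.
(* At a good strike the second derivative is known for all barriers at once; only such an equality
   of functions of [H] can be differentiated in [H]. *)
have VKK (K : R) : (forall H, is_derive K 1 (cumul_tail g H) (tail g H K)) ->
    (partial_K (partial_K V)) ^~ K = tail g ^~ K.
  move=> dK; apply/funext => H; rewrite /partial_K derive1E.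
  by have [_ ->] := dVK _ _ (dK H).
have dtail : {ae lebesgue2 R, forall z,
    is_derive (z.1 : R) 1 (fun y : R => tail g y z.2) (- g (z.2, z.1))}.
  apply: (@ae_plane_is_derive R (fun z => tail g z.1 z.2)
    (fun z => - g (z.2, z.1))).
  - exact: measurable_tail.
  - apply: measurableT_comp => //; apply: (measurableT_comp mg).
    exact: measurable_fun_pair.
  - by move=> k; exact: tail_continuous.
  - by move=> k; exact: ae_is_derive_tail.
split.
  have := ae_plane_snd good; move: dtail; apply: filterS2.
    exact: (ae_filter_ringOfSetsType (lebesgue2 R)).
  move=> z dtailz goodz _ _; split.
  - by have [] := dV z.1 z.2.
  - by have [] := dVK _ _ (goodz z.1).
  - by rewrite (VKK _ goodz); case: dtailz.
pose D : set (R * R)%type := `]0, +oo[ `*` `]0, +oo[.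
have oD : open D.
  by apply: openI; apply: open_comp => [z _|]; [exact: cvg_fst|
    exact: interval_open|exact: cvg_snd|exact: interval_open].
have mD : measurable (D : set (plane R)) by exact: open_plane_measurable.
(* Continuity of [h] is given on the open quadrant only, so [h] is set to [0] elsewhere. Almost
   surely [0 < ST <= M], hence the payoff is unchanged. *)
pose hs (z : plane R) : R := (h \_ D) (z.2, z.1).
have mhs : measurable_fun setT hs.
  apply: (measurableT_comp (f := h \_ D : plane R -> R)).
    apply/(measurable_restrictT _ _).1 => //.
    exact: open_continuous_plane_measurable_fun.
  exact: measurable_fun_pair.
have mhsX : measurable_fun setT (fun w => (hs (X w))%:E).
  exact/measurable_EFinP/(measurableT_comp mhs mphi).
have hsX : {ae Q, forall w, h (M w, ST w) = hs (X w)}.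
  apply: filterS ST_le_M => w wM; rewrite /hs patchE mem_set//.
  by split; rewrite /= in_itv/= andbT ?ST_gt0// (lt_le_trans _ wM).
have ihsX : Q.-integrable setT ((EFin \o hs) \o X).
  apply/integrableP; split => //; move/integrableP : f_int => [_].
  rewrite (@eq_integral_ae _ _ _ _ _ _ (fun w => `|(hs (X w))%:E|%E))//.
  by apply: filterS hsX => w -> _.
have mhsE : measurable_fun setT (EFin \o hs) by exact/measurable_EFinP.
have inu : nu.-integrable setT (EFin \o hs).
  exact: (integrable_pushforward mphi mhsE ihsX measurableT).
have [img nug] := integral_density mg g0 dens inu.
rewrite unlock.
transitivity (\int[nu]_z (hs z)%:E)%E.
  rewrite (integral_distribution mhsE ihsX).
  by apply: eq_integral_ae; apply: filterS hsX => w -> _.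
(* Fubini with the stock variable [y] outermost. The integrands are then compared for almost every
   [y], and for each such [y] for almost every [x]; [eq_integral_ae] permits this with no
   measurability known for [partial_HKK V]. *)
rewrite [LHS]nug -(integral12_prod_meas1 img) [RHS]integral_mkcond.
apply: eq_integral_ae; apply: filterS good.
  exact: (ae_filter_ringOfSetsType lebesgue_measure).
move=> y goody _; rewrite /fubini_F patchE; case: ifPn => y0; last first.
  rewrite integral0_eq// => x _; rewrite /= /hs patchE ifF ?mul0e//.
  by apply/negP => /set_mem[_ /= y0']; move: y0; rewrite mem_set.
rewrite [RHS]integral_mkcond; apply: eq_integral_ae.
apply: filterS (ae_is_derive_tail gs y).
  exact: (ae_filter_ringOfSetsType lebesgue_measure).
move=> x dx _; rewrite patchE /= /hs patchE in_setX y0 andbT.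
case: ifPn => x0; last by rewrite mul0e.
rewrite -EFinM /partial_HKK /partial_H (VKK _ goody) derive1E.
by have [_ ->] := dx; rewrite opprK mulrC.
Qed.
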